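(* Let $\Bbbk$ be a field and let $n$ be a positive integer. There is an isomorphism of $\Bbbk$-algebras $\Bbbk\mathcal{OF}_{n+1}\simeq\Bbbk\mathcal{IO}_{n}$.
   Context: $[n]=\{1,\ldots,n\}$. $\mathcal{OF}_n$ is the monoid (under composition) of all order-preserving functions $f:[n]\to[n]$ (i.e. $i_1\le i_2$ implies $f(i_1)\le f(i_2)$) such that $f(n)=n$. $\mathcal{IO}_n$ is the monoid (under composition of partial functions) of all order-preserving partial permutations of $[n]$, i.e. all partial injective functions $\theta:[n]\to[n]$ such that $\theta(i)<\theta(j)$ whenever $i<j$ are in the domain of $\theta$ (including the empty partial function). Functions are composed from right to left. $\Bbbk S$ denotes the semigroup algebra of $S$ over $\Bbbk$. *)

(* Defs.v *)
From HB Require Import structures.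
From mathcomp Require Import all_boot all_order all_algebra.
From mathcomp.multinomials Require Import monalg.

Set Implicit Arguments.
Unset Strict Implicit.
Unset Printing Implicit Defensive.

(* The set [n] = {1, ..., n} is represented by 'I_n = {0, ..., n-1}. Products
   are compositions from right to left: (f * g)(i) = f (g i).                  *)

Section OrderPreservingFunctions.

Variable n : nat.

(* The last clause says that f fixes the greatest element of 'I_n, if any. *)
Definition is_OF (f : {ffun 'I_n -> 'I_n}) : bool :=
  [forall i : 'I_n, forall j : 'I_n, (i <= j) ==> (f i <= f j)]
  && [forall i : 'I_n, (i.+1 == n) ==> (f i == i)].

Record OF := MkOF { OF_val :> {ffun 'I_n -> 'I_n}; _ : is_OF OF_val }.

HB.instance Definition _ := [isSub for OF_val].
HB.instance Definition _ := [Finite of OF by <:].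

Lemma is_OFP (f : {ffun 'I_n -> 'I_n}) :
  reflect ((forall i j : 'I_n, i <= j -> f i <= f j) /\
           (forall i : 'I_n, i.+1 = n -> f i = i))
          (is_OF f).
Proof.
apply: (iffP andP) => -[hm ht]; split.
- by move=> i j; move/forallP/(_ i)/forallP/(_ j)/implyP: hm; apply.
- by move=> i /eqP; move/forallP/(_ i)/implyP: ht => ht /ht/eqP.
- by apply/forallP=> i; apply/forallP=> j; apply/implyP/hm.
- by apply/forallP=> i; apply/implyP=> /eqP/ht/eqP.
Qed.

Lemma is_OF_id : is_OF [ffun i => i].
Proof. by apply/is_OFP; split=> [i j|i _]; rewrite !ffunE. Qed.

Lemma is_OF_comp (f g : OF) : is_OF [ffun i => f (g i)].
Proof.
have [/is_OFP[mf tf] /is_OFP[mg tg]] := (valP f, valP g).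
apply/is_OFP; split=> [i j leij|i iE]; rewrite !ffunE; first exact/mf/mg.
by rewrite (tg i iE) tf.
Qed.

Definition OF_one : OF := MkOF is_OF_id.
Definition OF_mul (f g : OF) : OF := MkOF (is_OF_comp f g).

Lemma OF_mulA : associative OF_mul.
Proof. by move=> f g h; apply/val_inj/ffunP=> i; rewrite /= !ffunE. Qed.

Lemma OF_mul1 : left_id OF_one OF_mul.
Proof. by move=> f; apply/val_inj/ffunP=> i; rewrite /= !ffunE. Qed.

Lemma OF_mulr1 : right_id OF_one OF_mul.
Proof. by move=> f; apply/val_inj/ffunP=> i; rewrite /= !ffunE. Qed.

Lemma increasing_ord_id (g : 'I_n -> 'I_n) :
  {homo g : i j / i < j} -> g =1 id.
Proof.
move=> mg.
have sorted_enum : sorted (fun i j : 'I_n => i < j) (enum 'I_n).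
  by have := iota_ltn_sorted 0 n; rewrite -val_enum_ord sorted_map.
have lt_trans : transitive (fun i j : 'I_n => i < j).
  by move=> j i k; apply: ltn_trans.
have inj_g : injective g.
  move=> i j gij; apply/val_inj; case: (ltngtP i j) => // /mg;
    by rewrite gij ltnn.
have eq_g : [seq g i | i <- enum 'I_n] = enum 'I_n.
  apply: (irr_sorted_eq lt_trans) => //; first by move=> i; rewrite /= ltnn.
    rewrite sorted_map; apply: sub_sorted sorted_enum => i j; exact: mg.
  move=> i; rewrite mem_enum; apply/mapP.
  by exists (invF inj_g i); rewrite ?mem_enum ?f_invF.
move=> i; have /eq_in_map := etrans eq_g (esym (map_id _)).
by apply; rewrite mem_enum.
Qed.

Lemma OF_unit (f g : OF) : OF_mul f g = OF_one -> f = OF_one /\ g = OF_one.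
Proof.
move=> fg1.
have fgK i : f (g i) = i.
  by move/(congr1 val)/ffunP/(_ i): fg1; rewrite /= !ffunE.
have g1 : g = OF_one.
  apply/val_inj/ffunP=> i; rewrite /= ffunE; move: i.
  have [/is_OFP[mg _]] := valP g.
  apply: increasing_ord_id => i j ltij; rewrite ltn_neqAle mg ?(ltnW ltij) //.
  rewrite andbT; apply: contraL ltij => /eqP/val_inj gij.
  by rewrite -(fgK i) gij fgK ltnn.
by split=> //; move: fg1; rewrite g1 OF_mulr1.
Qed.

(* monomType asks for the trivial group of units on top of the monoid axioms;
   both monoids of this file have it. *)
HB.instance Definition _ :=
  Choice_isMonomialDef.Build OF OF_mulA OF_mul1 OF_mulr1 OF_unit.

End OrderPreservingFunctions.

Section OrderPreservingPartialPermutations.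

Variable n : nat.

(* Partial functions on 'I_n have values in option 'I_n, and None means
   "undefined". *)
Definition pinjective (t : {ffun 'I_n -> option 'I_n}) : bool :=
  [forall i, forall j, (t i != None) ==> (t i == t j) ==> (i == j)].

Definition pincreasing (t : {ffun 'I_n -> option 'I_n}) : bool :=
  [forall i : 'I_n, forall j : 'I_n, (i < j) ==>
    (if (t i, t j) is (Some x, Some y) then x < y else true)].

Record IO := MkIO {
  IO_val :> {ffun 'I_n -> option 'I_n};
  _ : pinjective IO_val && pincreasing IO_val }.

HB.instance Definition _ := [isSub for IO_val].
HB.instance Definition _ := [Finite of IO by <:].

Lemma is_IOP (t : {ffun 'I_n -> option 'I_n}) :
  reflect ((forall i j x, t i = Some x -> t j = Some x -> i = j) /\
           (forall (i j x y : 'I_n),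
              i < j -> t i = Some x -> t j = Some y -> x < y))
          (pinjective t && pincreasing t).
Proof.
apply: (iffP andP) => -[hi hm]; split.
- move=> i j x ti tj; move/forallP/(_ i)/forallP/(_ j): hi.
  by rewrite ti tj eqxx => /eqP.
- move=> i j x y ltij ti tj; move/forallP/(_ i)/forallP/(_ j): hm.
  by rewrite ltij ti tj.
- apply/forallP=> i; apply/forallP=> j; case ti: (t i) => [x|] //=.
  by apply/implyP=> /eqP tj; apply/eqP/(hi i j x).
- apply/forallP=> i; apply/forallP=> j; apply/implyP=> ltij.
  by case ti: (t i) => [x|] //; case tj: (t j) => [y|] //; apply: (hm i j).
Qed.

Lemma is_IO_id (t := [ffun i => Some i] : {ffun 'I_n -> option 'I_n}) :
  pinjective t && pincreasing t.
Proof.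
apply/is_IOP; split=> [i j x|i j x y ltij]; rewrite !ffunE.
  by move=> [->] [->].
by move=> [<-] [<-].
Qed.

Lemma is_IO_comp (s t : IO) (u := [ffun i => obind s (t i)]) :
  pinjective u && pincreasing u.
Proof.
have [/is_IOP[injs ms] /is_IOP[injt mt]] := (valP s, valP t).
apply/is_IOP; split=> [i j x|i j x y ltij]; rewrite !ffunE;
  case ti: (t i) => [a|] //=; case tj: (t j) => [b|] //= sa sb.
  by move: tj; rewrite -(injs _ _ _ sa sb); apply: injt.
exact: ms (mt _ _ _ _ ltij ti tj) sa sb.
Qed.

Definition IO_one : IO := MkIO is_IO_id.
Definition IO_mul (s t : IO) : IO := MkIO (is_IO_comp s t).

Lemma IO_mulA : associative IO_mul.
Proof.
move=> r s t; apply/val_inj/ffunP=> i; rewrite /= !ffunE.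
by case: (t i) => //= a; rewrite ffunE.
Qed.

Lemma IO_mul1 : left_id IO_one IO_mul.
Proof.
move=> t; apply/val_inj/ffunP=> i; rewrite /= !ffunE.
by case: (t i) => //= a; rewrite ffunE.
Qed.

Lemma IO_mulr1 : right_id IO_one IO_mul.
Proof. by move=> t; apply/val_inj/ffunP=> i; rewrite /= !ffunE. Qed.

Lemma IO_unit (s t : IO) : IO_mul s t = IO_one -> s = IO_one /\ t = IO_one.
Proof.
move=> st1.
have stK i : obind s (t i) = Some i.
  by move/(congr1 val)/ffunP/(_ i): st1; rewrite /= !ffunE.
have t1 : t = IO_one.
  have tE i : t i = Some (odflt i (t i)) by move: (stK i); case: (t i).
  apply/val_inj/ffunP=> i; rewrite /= ffunE tE; congr Some; move: i.
  have /is_IOP[_ mt] := valP t.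
  by apply: increasing_ord_id => i j ltij; apply: (mt i j).
by split=> //; move: st1; rewrite t1 IO_mulr1.
Qed.

HB.instance Definition _ :=
  Choice_isMonomialDef.Build IO IO_mulA IO_mul1 IO_mulr1 IO_unit.

End OrderPreservingPartialPermutations.

(* Main.v *)
From HB Require Import structures.
Require Import Defs.
From mathcomp Require Import all_boot all_order all_algebra.
From mathcomp.multinomials Require Import monalg.

Set Implicit Arguments.
Unset Strict Implicit.
Unset Printing Implicit Defensive.

Import GRing.Theory.

Local Open Scope ring_scope.

(** Reading the top element as undefined turns a map f in OF_(n+1) into a
    monotone partial map of [n], its truncation, and the elements of IO_n are
    monotone partial maps of [n] by definition. So let K be either monoid, let
    it act on [n] by monotone partial maps, and send m in K to the formal sum of
    all t in IO_n that are restrictions of m ([restriction_sum]).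

    The target is the space of functions on IO_n, with the convolution product
    of the groupoid of order isomorphisms between subsets of [n]: the product
    of u and v is their composite if the domain of u is exactly the image of v,
    and zero otherwise. A restriction t of a composite x y factors in one and
    only one way as u v with u a restriction of x, v a restriction of y and
    dom u = im v: v is y cut down to dom t, and u is x cut down to im v
    ([factors_exist], [factors_unique]). Hence [restriction_sum] is
    multiplicative for both monoids ([restriction_sumM]); for OF_(n+1) this is
    the action on the exterior powers of the natural module modulo the top
    element, and for IO_n it is the usual Moebius-type isomorphism of an inverse
    monoid algebra with its groupoid algebra.

    It is also bijective for both. An s in IO_n has a distinguished extension
    in K: s itself if K = IO_n, and if K = OF_(n+1) the map sending x to s(a),
    with a the least element of dom s that is at least x, or to the top if none is
    ([extension], a bijection by [extension_bij], whose inverse keeps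
    the largest point of each fibre). If another t restricts the extension of s,
    then every point of dom t lies at or below the point of dom s with the same
    image, so the sum of dom t is smaller than that of dom s
    ([rank_restricts]). In the bases IO_n and K thus indexed, [restriction_sum]
    is therefore unitriangular ([restriction_sum_bij]).

    The isomorphism is [restriction_sum] for OF_(n+1) followed by the inverse of
    [restriction_sum] for IO_n. *)

(** * Two facts of linear algebra *)

(** The target [W] only carries a binary operation, so that no ring structure
    on it has to be built: its axioms hold on the image of [G] because they hold
    in [V]. *)
Lemma lrmorphism_of_common_image (k : nzRingType) (U V : lalgType k)
    (W : lmodType k) (mulW : W -> W -> W)
    (F : {linear U -> W}) (G : {linear V -> W}) :
    bijective F -> bijective G ->
    {morph F : x y / x * y >-> mulW x y} ->
    {morph G : x y / x * y >-> mulW x y} ->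
    F 1 = G 1 ->
  exists phi : {lrmorphism U -> V}, bijective phi.
Proof.
move=> bijF [G' GK G'K] FM GM FG1.
have injG := can_inj GK.
pose f := G' \o F.
have Gf x : G (f x) = F x by rewrite /f /= G'K.
have f_lin : linear f by move=> c x y; apply: injG; rewrite linearP !Gf linearP.
have f_mul : monoid_morphism f.
  by split=> [|x y]; apply: injG; rewrite ?GM !Gf.
pose fL := GRing.isLinear.Build k U V *:%R f f_lin.
pose fM := GRing.isMonoidMorphism.Build U V f f_mul.
pose phi : {lrmorphism U -> V} := HB.pack f fL fM.
by exists phi; apply: bij_comp bijF; exists G.
Qed.

(** A nonzero kernel vector has a nonzero entry of largest rank, and the
    equation of that row says that this entry vanishes; an injective
    endomorphism of a finite-dimensional space is bijective. *)
Lemma unitriangular_bij (k : fieldType) (I : finType) (rank : I -> nat)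
    (a : I -> I -> k) :
    (forall i, a i i = 1) ->
    (forall i j, i != j -> a i j != 0 -> (rank i < rank j)%N) ->
  bijective (fun x : {ffun I -> k} => [ffun i => \sum_j x j * a i j]).
Proof.
move=> a1 a_tri; set f := (X in bijective X).
pose g (x : {ffun I -> k^o}) : {ffun I -> k^o} := f x.
have g_lin : linear g.
  move=> c x y; apply/ffunP=> i; rewrite !ffunE scaler_sumr -big_split /=.
  by apply: eq_bigr => j _; rewrite !ffunE mulrDl scalerAl.
pose gL : {linear {ffun I -> k^o} -> {ffun I -> k^o}} :=
  HB.pack g (GRing.isLinear.Build _ _ _ _ g g_lin).
have ker0 : lker (linfun gL) == 0%VS.
  rewrite -subv0; apply/subvP=> x; rewrite memv_ker lfunE memv0 => /eqP gx0.
  apply/eqP/ffunP=> i; rewrite ffunE.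
  (* Downward induction on the rank, in the form of N - rank i. *)
  pose N := \max_i rank i.
  have [d] := ubnP (N - rank i)%N; elim: d i => // d IHd i lti.
  have /ffunP/(_ i) := gx0; rewrite !ffunE (bigD1 i) //= a1 mulr1.
  rewrite big1 ?addr0 // => j neqji.
  have [->|aij] := eqVneq (a i j) 0; first by rewrite mulr0.
  have lt_ij := a_tri _ _ (contra_neq (@esym _ _ _) neqji) aij.
  have leN : (rank j <= N)%N by apply: leq_bigmax.
  rewrite IHd ?mul0r // -ltnS (leq_trans _ lti) // ltnS.
  by rewrite ltn_sub2l // (leq_trans lt_ij).
have gE x : linfun gL x = f x by rewrite lfunE.
exists (linfun gL)^-1%VF => x.
  by rewrite -gE lker0_lfunK.
by rewrite -gE lker0_lfunVK.
Qed.

(** * Order isomorphisms between subsets of [n], as restrictions *)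
Section Restriction.

Variable n : nat.
Implicit Types (s t u v : IO n) (p q : 'I_n -> option 'I_n).

Definition restricts t p := [forall i, (t i == None) || (t i == p i)].

Lemma restrictsP t p :
  reflect (forall i j, t i = Some j -> p i = Some j) (restricts t p).
Proof.
apply: (iffP forallP) => tp i.
  by move=> j ti; have := tp i; rewrite ti => /eqP.
by case ti: (t i) => [j|] //=; rewrite (tp _ _ ti).
Qed.

Definition pmonotone p := forall i j a b : 'I_n,
  (i <= j)%N -> p i = Some a -> p j = Some b -> (a <= b)%N.

Lemma restriction_IO p (D : pred 'I_n) :
    pmonotone p ->
    (forall i j a, D i -> D j -> p i = Some a -> p j = Some a -> i = j) ->
  exists t, forall i, t i = if D i then p i else None.
Proof.
move=> p_mono p_inj; pose f := [ffun i => if D i then p i else None].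
have f_IO : pinjective f && pincreasing f.
  apply/is_IOP; split=> [i j a|i j a b ltij]; rewrite !ffunE;
    case Di: (D i) => //; case Dj: (D j) => // pi pj; first exact: p_inj pi pj.
  rewrite ltn_neqAle (p_mono _ _ _ _ (ltnW ltij) pi pj) andbT.
  apply: contraTneq ltij => /val_inj eq_ab; rewrite -eq_ab in pj.
  by rewrite (p_inj _ _ _ Di Dj pi pj) ltnn.
by exists (MkIO f_IO) => i; rewrite /= ffunE.
Qed.

(** Equality of the domain of [u] and the image of [v]: composability in the
    groupoid of order isomorphisms, stricter than that of partial maps. *)
Definition composable u v :=
  [forall j, (u j != None) == [exists i, v i == Some j]].

Lemma composableP u v :
  reflect (forall j, u j <> None <-> exists i, v i = Some j) (composable u v).
Proof.
apply: (iffP forallP) => uv j; last first.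
  apply/eqP; apply/idP/existsP.
    by move=> /eqP/(proj1 (uv j))[i vi]; exists i; apply/eqP.
  by move=> [i /eqP vi]; apply/eqP/(proj2 (uv j)); exists i.
have /eqP uvj := uv j; split=> [/eqP|[i vi]]; last first.
  by apply/eqP; rewrite uvj; apply/existsP; exists i; apply/eqP.
by rewrite uvj => /existsP[i /eqP vi]; exists i.
Qed.

Definition factors t (w : IO n * IO n) :=
  composable w.1 w.2 && (IO_mul w.1 w.2 == t).

Lemma factorsP t w :
  factors t w -> composable w.1 w.2 /\ forall i, t i = obind w.1 (w.2 i).
Proof. by case/andP=> ? /eqP<-; split=> // i; rewrite ffunE. Qed.

(** Cut [q] down to the domain of [t], which gives [v], and then [p] down to
    the image of [v]. Both cuts are injective because [t] is, and monotonicity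
    of [p] and [q] makes them strictly increasing. *)
Lemma factors_exist t p q :
    pmonotone p -> pmonotone q -> restricts t (fun i => obind p (q i)) ->
  exists w, [/\ factors t w, restricts w.1 p & restricts w.2 q].
Proof.
move=> p_mono q_mono /restrictsP t_pq; have /is_IOP[t_inj _] := valP t.
have [|v vE] := @restriction_IO q (fun i => t i != None) q_mono.
  move=> i j a; case ti: (t i) => [b|] //; case tj: (t j) => [c|] // _ _ qi qj.
  have := t_pq _ _ tj; have := t_pq _ _ ti; rewrite qi qj /= => -> [eq_bc].
  by apply: t_inj ti _; rewrite eq_bc.
have v_q i j : v i = Some j -> q i = Some j by rewrite vE; case: ifP.
have tE i : t i = obind p (v i).
  rewrite vE; case ti: (t i) => [b|] //=.
  by rewrite (t_pq _ _ ti).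
have v_dom i j : v i = Some j -> t i <> None by rewrite vE; case: (t i).
have [|u uE] := @restriction_IO p (fun j => [exists i, v i == Some j]) p_mono.
  move=> i j a /existsP[i' /eqP vi'] /existsP[j' /eqP vj'] pi pj.
  have eq_ij : i' = j' by apply: (t_inj _ _ a); rewrite tE ?vi' ?vj'.
  by move: vi'; rewrite eq_ij vj' => -[].
have uv i : obind u (v i) = t i.
  rewrite tE; case vi: (v i) => [j|] //=; rewrite uE ifT //.
  by apply/existsP; exists i; apply/eqP.
exists (u, v); split=> /=; last 2 first.
- by apply/restrictsP=> i j; rewrite uE; case: ifP.
- exact/restrictsP.
apply/andP; split=> /=; last first.
  by apply/eqP/val_inj/ffunP=> i; rewrite ffunE uv.
apply/composableP=> j; split=> [|[i vi]].
  by rewrite uE; case: existsP => // -[i /eqP vi] _; exists i.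
by have := v_dom _ _ vi; rewrite -uv vi.
Qed.

(** Composability forces [v] to have the domain of [t], and [u] the image of
    [v] as its domain; a restriction is determined by its domain. *)
Lemma factors_unique t p q w w' :
    factors t w -> restricts w.1 p -> restricts w.2 q ->
    factors t w' -> restricts w'.1 p -> restricts w'.2 q ->
  w = w'.
Proof.
move: w w' => [u v] [u' v'] /factorsP[/composableP/= uv tE] /restrictsP up
  /restrictsP vq /factorsP[/composableP/= uv' tE'] /restrictsP up'
  /restrictsP vq'.
have dom_v (a b : IO n) i :
    (forall j, a j <> None <-> exists i, b i = Some j) ->
    (b i == None) = (obind a (b i) == None).
  move=> ab; case bi: (b i) => [j|] //=; apply/esym/eqP.
  by apply/(proj2 (ab j)); exists i.
have eq_v : v = v'.
  apply/val_inj/ffunP=> i /=.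
  have: (v i == None) = (v' i == None).
    by rewrite (dom_v _ _ _ uv) (dom_v _ _ _ uv') -tE -tE'.
  case vi: (v i) => [j|]; case vi': (v' i) => [j'|] //= _.
  by rewrite -(vq _ _ vi) -(vq' _ _ vi').
subst v'; congr pair; apply/val_inj/ffunP=> j /=.
have eq_dom : u j <> None <-> u' j <> None by rewrite uv uv'.
case uj: (u j) => [a|]; case uj': (u' j) => [a'|] //.
- by rewrite -(up _ _ uj) -(up' _ _ uj').
- by have /(proj1 eq_dom) : u j <> None by rewrite uj.
- by have /(proj2 eq_dom) : u' j <> None by rewrite uj'.
Qed.

Lemma restricts_factors t p q w :
    factors t w -> restricts w.1 p -> restricts w.2 q ->
  restricts t (fun i => obind p (q i)).
Proof.
move=> /factorsP[_ tE] /restrictsP up /restrictsP vq; apply/restrictsP=> i j.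
by rewrite tE; case vi: (w.2 i) => [a|] //= /up; rewrite (vq _ _ vi).
Qed.

(** One plus the preimage of [b], and zero outside the image, so that being in
    the image already makes it positive. *)
Definition pos t (b : 'I_n) : nat :=
  if [pick a | t a == Some b] is Some a then a.+1 else 0.

Lemma posE t (a b : 'I_n) : (t a == Some b) = (pos t b == a.+1).
Proof.
rewrite /pos; case: pickP => [a' /eqP ta'|/(_ a)] //.
rewrite eqSS; have /is_IOP[t_inj _] := valP t.
apply/eqP/eqP=> [ta|/val_inj<-] //; congr (val _); exact: t_inj ta' ta.
Qed.

(** The sum of the domain of [t], with the points of [n] counted from 1; it is
    indexed by the image, where two partial maps can be compared pointwise. *)
Definition rank t : nat := \sum_b pos t b.

(** This holds when [p] is the distinguished extension of [s], whose values are
    those of [s] at the same point or further up. *)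
Definition pushes_up s p := forall i b,
  p i = Some b -> exists2 a : 'I_n, (i <= a)%N & s a = Some b.

(** Both hypotheses together give [pos t b <= pos s b] for every [b], with
    equality everywhere only if [t = s], since [t] is recovered from [pos t]. *)
Lemma rank_restricts s t p :
  pushes_up s p -> restricts t p -> t != s -> (rank t < rank s)%N.
Proof.
move=> sp /restrictsP tp neq_ts.
have le_pos b : (pos t b <= pos s b ?= iff (pos t b == pos s b))%N.
  split=> //; case tb: (pos t b) => [//|a].
  have lt_an : (a < n)%N.
    by move: tb; rewrite /pos; case: pickP => // a' _ [<-].
  have /eqP/tp/sp[c le_ac /eqP] : t (Ordinal lt_an) == Some b by rewrite posE tb.
  by rewrite posE => /eqP->.
have /leqifP := leqif_sum (fun b (_ : true) => le_pos b).
case: forallP => //= eq_pos; case/eqP: neq_ts; apply/val_inj/ffunP=> i /=.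
have tsE b : (t i == Some b) = (s i == Some b).
  by rewrite !posE; have /eqP-> := eq_pos b.
case ti: (t i) => [b|]; first by apply/esym/eqP; rewrite -tsE ti.
by case si: (s i) => [b|] //; have := tsE b; rewrite ti si eqxx.
Qed.

End Restriction.

(** * The map to the groupoid algebra *)
Section RestrictionCount.

Variables (k : fieldType) (n : nat) (K : monomType).
Variable act : K -> 'I_n -> option 'I_n.

(** The monoid [K] acts on [n] by partial maps; [m] is sent to the sum of the
    groupoid elements [t] that restrict it, here given by its coefficients. *)
Definition restriction_sum (x : {malg k[K]}) : {ffun IO n -> k^o} :=
  [ffun t => mmap idfun (fun m => (restricts t (act m))%:R) x].

Lemma restriction_sum_is_linear : linear restriction_sum.
Proof.
move=> c x y; apply/ffunP=> t; rewrite !ffunE raddfD; congr (_ + _).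
rewrite /= (mmapEw (msuppZ_le c x)) mmapE scaler_sumr.
by apply: eq_bigr => m _; rewrite mcoeffZ /= -mulrA.
Qed.

HB.instance Definition _ :=
  GRing.isLinear.Build k {malg k[K]} {ffun IO n -> k^o} *:%R restriction_sum
    restriction_sum_is_linear.

Definition groupoid_mul (F G : {ffun IO n -> k^o}) : {ffun IO n -> k^o} :=
  [ffun t => \sum_(w | factors t w) F w.1 * G w.2].

Hypothesis act1 : forall i, act mone i = Some i.
Hypothesis actM : forall x y i, act (mmul x y) i = obind (act x) (act y i).
Hypothesis act_mono : forall m, pmonotone (act m).

(** Multiplicativity on a pair of basis elements: the sum counts the groupoid
    factorizations of [t] along [x] and [y], and there is one or none. *)
Lemma restricts_act_mul t x y :
  (restricts t (act (mmul x y)))%:R =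
  \sum_(w | factors t w)
    (restricts w.1 (act x))%:R * (restricts w.2 (act y))%:R :> k.
Proof.
have -> : restricts t (act (mmul x y)) =
    restricts t (fun i => obind (act x) (act y i)).
  by apply: eq_forallb => i; rewrite actM.
have [t_xy|t_xy] := boolP (restricts t _); last first.
  rewrite big1 // => w tw; rewrite -natrM mulnb; case: andP => // -[ux vy].
  by rewrite (restricts_factors tw ux vy) in t_xy.
have [w [tw ux vy]] := factors_exist (@act_mono x) (@act_mono y) t_xy.
rewrite (bigD1 w) //= ux vy mulr1 big1 ?addr0 // => w' /andP[tw' neq_w'].
rewrite -natrM mulnb; case: andP => // -[ux' vy'].
by rewrite (factors_unique tw ux vy tw' ux' vy') eqxx in neq_w'.
Qed.

Lemma restriction_sumM :
  {morph restriction_sum : x y / x * y >-> groupoid_mul x y}.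
Proof.
move=> x y; apply/ffunP=> t; rewrite !ffunE malgME raddf_sum /=.
under eq_bigr => i _.
  rewrite raddf_sum /=; under eq_bigr => j _ do
    rewrite mmapU restricts_act_mul mulr_sumr.
  rewrite exchange_big /=; over.
rewrite exchange_big /=; apply: eq_bigr => w _; rewrite !ffunE !mmapE mulr_suml.
apply: eq_bigr => i _; rewrite mulr_sumr; apply: eq_bigr => j _ /=.
by rewrite mulrACA.
Qed.

Lemma restriction_sum1 t :
  restriction_sum 1 t = (restricts t Some)%:R.
Proof.
rewrite ffunE mmapU mul1r; congr (nat_of_bool _)%:R.
by apply: eq_forallb => i; rewrite act1.
Qed.

(* The indexing of the basis [K] by IO_n that makes the map unitriangular. *)
Variable ext : IO n -> K.
Hypothesis ext_bij : bijective ext.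
Hypothesis ext_restricts : forall s, restricts s (act (ext s)).
Hypothesis ext_up : forall s, pushes_up s (act (ext s)).

Lemma restriction_sum_bij : bijective restriction_sum.
Proof.
have [ext' extK ext'K] := ext_bij.
pose c (x : {malg k[K]}) : {ffun IO n -> k} := [ffun s => x@_(ext s)].
pose c' (y : {ffun IO n -> k}) : {malg k[K]} := \sum_s << y s *g ext s >>.
have c'E y s : (c' y)@_(ext s) = y s.
  rewrite raddf_sum (bigD1 s) //= mcoeffUU big1 ?addr0 // => t neq_ts.
  by rewrite mcoeffU (can_eq extK) (negPf neq_ts).
have cK : cancel c c'.
  by move=> x; apply/malgP=> m; rewrite -(ext'K m) c'E ffunE.
have c_bij : bijective c.
  by exists c' => // y; apply/ffunP=> s; rewrite ffunE c'E.
have sumE : restriction_sum =1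
    (fun y : {ffun IO n -> k} =>
      [ffun t => \sum_s y s * (restricts t (act (ext s)))%:R]) \o c.
  move=> x; rewrite -{1}(cK x); apply/ffunP=> t; rewrite !ffunE raddf_sum /=.
  by apply: eq_bigr => s _; rewrite mmapU.
apply: eq_bij (fsym sumE); apply: bij_comp c_bij.
apply: (@unitriangular_bij _ _ (@rank n)) => [s|s t neq_st].
  by rewrite ext_restricts.
case st: (restricts _ _); last by rewrite eqxx.
by move=> _; apply: rank_restricts st neq_st; apply: ext_up.
Qed.

End RestrictionCount.

(** * Functions fixing the top element, as extensions of partial permutations *)
Section OrderPreservingFunctionsFixingTop.

Variable n : nat.
Implicit Types (f g : OF n.+1) (s : IO n) (i j : 'I_n).

(** [lift ord_max] embeds 'I_n as the elements below the top of 'I_n.+1, and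
    [unlift ord_max] turns the top into [None]. *)
Definition truncate f i : option 'I_n := unlift ord_max (f (lift ord_max i)).

Lemma truncateE f i j :
  (truncate f i == Some j) = (f (lift ord_max i) == lift ord_max j).
Proof.
rewrite /truncate; case: unliftP => [j' ->|->].
  by rewrite (inj_eq lift_inj); apply/eqP/eqP=> [[]|->].
by rewrite eq_sym (negPf (neq_lift _ _)).
Qed.

Lemma OF_max f : f ord_max = ord_max.
Proof. by have /is_OFP[_] := valP f; apply. Qed.

Lemma OF_homo f : {homo f : i j / (i <= j)%N}.
Proof. by have /is_OFP[] := valP f. Qed.

Lemma truncate1 i : truncate (mone : OF n.+1) i = Some i.
Proof. by apply/eqP; rewrite truncateE ffunE. Qed.

(** Composition of partial maps is respected because [f] fixes the top: what is
    undefined for [g] stays undefined after [f]. *)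
Lemma truncateM f g i :
  truncate (mmul f g) i = obind (truncate f) (truncate g i).
Proof.
rewrite [LHS]/truncate ffunE {2}/truncate.
by case: (unliftP ord_max (g _)) => [j ->|->] //=; rewrite OF_max unlift_none.
Qed.

Lemma truncate_mono f : pmonotone (truncate f).
Proof.
move=> i j a b le_ij /eqP; rewrite truncateE => /eqP fi.
move=> /eqP; rewrite truncateE => /eqP fj.
by rewrite -(lift_max a) -(lift_max b) -fi -fj OF_homo // !lift_max.
Qed.

(** The candidate values at [x] of an extension of [s]: the values of [s] at or
    above [x], and the top. If [y] is not the top, then [unlift ord_max y] is
    not [None]. *)
Definition reaches s (x y : 'I_n.+1) :=
  (y == ord_max) || [exists a : 'I_n, (x <= a)%N && (s a == unlift ord_max y)].

Lemma reaches_max s x : reaches s x ord_max.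
Proof. by rewrite /reaches eqxx. Qed.

Lemma reaches_liftP s (x : 'I_n.+1) j :
  reflect (exists2 a : 'I_n, (x <= a)%N & s a = Some j)
          (reaches s x (lift ord_max j)).
Proof.
rewrite /reaches eq_sym (negPf (neq_lift _ _)) liftK.
apply: (iffP existsP) => [[a /andP[le_xa /eqP sa]]|[a le_xa sa]]; exists a => //.
by rewrite le_xa sa eqxx.
Qed.

Lemma reachesS s (x x' y : 'I_n.+1) :
  (x <= x')%N -> reaches s x' y -> reaches s x y.
Proof.
move=> le_xx'; rewrite /reaches; case/orP=> [->//|/existsP[a /andP[le_xa sa]]].
apply/orP; right; apply/existsP; exists a.
by rewrite sa (leq_trans le_xx').
Qed.

(** As [s] is increasing, the least value that it takes at or above [x] is its
    value at the least such point of its domain; minimizing the value rather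
    than the point makes monotonicity immediate. *)
Definition extension_fun s : {ffun 'I_n.+1 -> 'I_n.+1} :=
  [ffun x => [arg min_(y < ord_max | reaches s x y) (y : nat)]].

Lemma extension_funP s x :
  reaches s x (extension_fun s x) /\
  forall y, reaches s x y -> (extension_fun s x <= y)%N.
Proof.
by rewrite ffunE; case: arg_minnP; rewrite ?reaches_max.
Qed.

Lemma extension_is_OF s : is_OF (extension_fun s).
Proof.
apply/is_OFP; split=> [x y le_xy|x [xn]].
  have [_] := extension_funP s x; apply; apply: reachesS le_xy _.
  by have [] := extension_funP s y.
have -> : x = ord_max by apply: val_inj.
have [r _] := extension_funP s ord_max; move: r.
case: (unliftP ord_max (extension_fun s ord_max)) => [j ->|-> //].
by case/reaches_liftP=> a; rewrite /= leqNgt ltn_ord.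
Qed.

Definition extension s : OF n.+1 := MkOF (extension_is_OF s).

Lemma extension_up s : pushes_up s (truncate (extension s)).
Proof.
move=> i j /eqP; rewrite truncateE /= => /eqP sij.
have [+ _] := extension_funP s (lift ord_max i).
by rewrite sij => /reaches_liftP[a]; rewrite lift_max; exists a.
Qed.

(** At a point of its domain, [s] increasing makes its own value the least of
    those reached. *)
Lemma restricts_extension s : restricts s (truncate (extension s)).
Proof.
apply/restrictsP=> i j si; apply/eqP; rewrite truncateE /=.
have [+ min_s] := extension_funP s (lift ord_max i).
have le_j : (extension_fun s (lift ord_max i) <= lift ord_max j)%N.
  by apply/min_s/reaches_liftP; exists i; rewrite ?lift_max.
have [j' E|E] := unliftP ord_max (extension_fun s (lift ord_max i)); last first.
  by move: le_j; rewrite E lift_max /= leqNgt ltn_ord.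
rewrite E => /reaches_liftP[a]; rewrite lift_max leq_eqVlt.
case/orP=> [/eqP/val_inj<-|lt_ia] sa.
  by move: sa; rewrite si => -[->].
have /is_IOP[_ /(_ _ _ _ _ lt_ia si sa)] := valP s.
by rewrite ltnNge; move: le_j; rewrite E !lift_max => ->.
Qed.

(** These are the largest points of the fibres of [f] over elements below the
    top, and they form the domain of the partial permutation that [f] extends.
    [inord i.+1] is the successor of [i] in 'I_n.+1. *)
Definition jumps f i := (f (lift ord_max i) < f (inord i.+1))%N.

(** Distinct jumps have distinct values, [f] being monotone. *)
Lemma core_exists f :
  exists s, forall i, s i = if jumps f i then truncate f i else None.
Proof.
apply: restriction_IO (@truncate_mono f) _ => i j a ji jj.
move=> /eqP; rewrite truncateE => /eqP fi.
move=> /eqP; rewrite truncateE => /eqP fj.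
have no_lt i' j' : (i' < j')%N -> jumps f i' ->
    f (lift ord_max i') <> f (lift ord_max j').
  move=> lt_ij; rewrite /jumps => /leq_trans lt_f eq_f.
  have /lt_f : (f (inord i'.+1) <= f (lift ord_max j'))%N.
    by apply: OF_homo; rewrite inordK ?lift_max // ltnS.
  by rewrite eq_f ltnn.
apply: val_inj; case: (ltngtP i j) => // lt_ij.
  by case: (no_lt _ _ lt_ij ji); rewrite fi fj.
by case: (no_lt _ _ lt_ij jj); rewrite fi fj.
Qed.

Lemma last_preimage f i j : f (lift ord_max i) = lift ord_max j ->
  exists2 a : 'I_n, (i <= a)%N &
    jumps f a /\ f (lift ord_max a) = lift ord_max j.
Proof.
move=> fi; pose P (a : 'I_n) := f (lift ord_max a) == lift ord_max j.
have Pi : P i by apply/eqP.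
case: (@arg_maxnP _ i P (fun a => a) Pi) => a /eqP fa a_max.
exists a; first exact: a_max.
split=> //; rewrite /jumps ltn_neqAle OF_homo ?andbT; last first.
  by rewrite inordK ?lift_max // ltnS.
rewrite fa; apply/negP=> /eqP/val_inj f_next.
(* The successor of [a] is either an element above [a], against maximality, or
   the top, which is fixed. *)
have [b bE|bE] := unliftP ord_max (inord a.+1 : 'I_n.+1).
  have := a_max b; rewrite /P -bE -f_next eqxx => /(_ isT).
  have : (b : nat) = a.+1 by rewrite -(lift_max b) -bE inordK // ltnS.
  by move=> -> /=; rewrite ltnn.
by move: f_next (neq_lift ord_max j); rewrite bE OF_max => ->; rewrite eqxx.
Qed.

(** The value [f x] is reached, through the last point of its fibre, and every
    value reached is the top or the value of [f] at some point not below [x]. *)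
Lemma extension_core f s :
  (forall i, s i = if jumps f i then truncate f i else None) -> extension s = f.
Proof.
move=> sE; apply/val_inj/ffunP=> /= x.
have s_f i j : s i = Some j -> f (lift ord_max i) = lift ord_max j.
  by rewrite sE; case: ifP => // _ /eqP; rewrite truncateE => /eqP.
have reaches_f : reaches s x (f x).
  have [j fx|->] := unliftP ord_max (f x); last exact: reaches_max.
  rewrite fx; apply/reaches_liftP.
  have [i xE|xE] := unliftP ord_max x; last first.
    by move: fx (neq_lift ord_max j); rewrite xE OF_max => <-; rewrite eqxx.
  have [|a le_ia [ja fa]] := @last_preimage f i j; first by rewrite -xE.
  exists a; first by rewrite xE lift_max.
  by rewrite sE ja; apply/eqP; rewrite truncateE fa.
have [r min_r] := extension_funP s x; apply/val_inj/anti_leq.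
rewrite min_r //=; move: r; have [j ->|->] := unliftP ord_max (extension_fun s x).
  case/reaches_liftP=> a le_xa /s_f <-; apply: OF_homo.
  by rewrite lift_max.
by rewrite leq_ord.
Qed.

(** If two partial permutations had the same extension, each would restrict the
    extension of the other, and so have the smaller rank. *)
Lemma extension_inj : injective extension.
Proof.
move=> s t eq_st; apply/eqP; apply: contraT => neq_st.
have lt_st : (rank s < rank t)%N.
  apply: rank_restricts (@extension_up t) _ neq_st.
  by rewrite -eq_st restricts_extension.
suff : (rank t < rank s)%N by rewrite ltnNge ltnW.
apply: rank_restricts (@extension_up s) _ _; last by rewrite eq_sym.
by rewrite eq_st restricts_extension.
Qed.

Lemma extension_bij : bijective extension.
Proof.
have surj f : exists s, extension s == f.
  by have [s sE] := core_exists f; exists s; rewrite (extension_core sE).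
have surjK f : extension (xchoose (surj f)) = f := eqP (xchooseP (surj f)).
by exists (fun f => xchoose (surj f)) => // s; apply: extension_inj.
Qed.

End OrderPreservingFunctionsFixingTop.

Lemma IO_pmonotone n (s : IO n) : pmonotone s.
Proof.
have /is_IOP[_ s_incr] := valP s.
move=> i j a b; rewrite leq_eqVlt => /orP[/eqP/val_inj<- -> [->] //|].
by move=> lt_ij si sj; rewrite ltnW // (s_incr _ _ _ _ lt_ij si sj).
Qed.

Theorem proposition4p9 (k : fieldType) (n : nat) (n_gt0 : (0 < n)%N) :
  exists phi : {lrmorphism {malg k[OF n.+1]} -> {malg k[IO n]}}, bijective phi.
Proof.
have one_id i : (mone : IO n) i = Some i by rewrite ffunE.
have mul_comp (s t : IO n) i : (mmul s t) i = obind s (t i) by rewrite ffunE.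
apply: (@lrmorphism_of_common_image k _ _ _ (@groupoid_mul k n)
  (@restriction_sum k n (OF n.+1) (@truncate n))
  (@restriction_sum k n (IO n) (fun s => s))).
- apply: restriction_sum_bij (@extension_bij n) (@restricts_extension n) _.
  exact: extension_up.
- apply: (@restriction_sum_bij _ _ _ _ id) => [|s|s i j sij].
  + by exists id.
  + exact/restrictsP.
  + by exists i.
- apply: restriction_sumM; [exact: truncateM | exact: truncate_mono].
- apply: restriction_sumM; [exact: mul_comp | exact: IO_pmonotone].
- apply/ffunP=> t; rewrite !restriction_sum1 //; exact: truncate1.
Qed.
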